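(* Let $X$ be a real Hausdorff locally convex space, $T$ a topological space, $f_t:X\to\overline{\mathbb{R}}$ ($t\in T$) convex functions, and $f:=\sup_{t\in T}f_t$. Assume that $$\operatorname{cl}f=\sup_{t\in T}(\operatorname{cl}f_t).$$ Let $x\in X$ be such that for some $\varepsilon_0>0$: (i) the set $T_{\varepsilon_0}(x)$ is compact; (ii) for every $z\in\operatorname{dom}(\operatorname{cl}f)$, the function $t\mapsto(\operatorname{cl}f_t)(z)$ is upper semicontinuous on $T_{\varepsilon_0}(x)$. Then $$\partial f(x)=\bigcap_{L\in\mathcal{F}(x)}\overline{\operatorname{co}}\Big\{\bigcup_{t\in T(x)}\partial(f_t+\mathrm{I}_{L\cap\operatorname{dom}f})(x)\Big\},$$ where $\mathcal{F}(x)$ is the family of finite-dimensional linear subspaces $L$ of $X$ such that $x\in L$.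
   Context: $\overline{\mathbb{R}}=\mathbb{R}\cup\{\pm\infty\}$, with the convention $(+\infty)+(-\infty)=(-\infty)+(+\infty)=+\infty$. $X^*$ is the topological dual of $X$, endowed with the weak*-topology, and $\langle\cdot,\cdot\rangle$ is the canonical pairing. For a convex $\varphi:X\to\overline{\mathbb{R}}$: $\operatorname{dom}\varphi=\{x\in X:\varphi(x)<+\infty\}$; $\operatorname{cl}\varphi$ is the lower semicontinuous envelope of $\varphi$; the subdifferential is $\partial\varphi(x)=\{x^*\in X^*:\varphi(y)-\varphi(x)\ge\langle x^*,y-x\rangle\ \forall y\in X\}$ if $\varphi(x)\in\mathbb{R}$, and $\partial\varphi(x)=\emptyset$ if $\varphi(x)\notin\mathbb{R}$. $\mathrm{I}_A$ is the indicator function of $A$ ($0$ on $A$, $+\infty$ off $A$). $\overline{\operatorname{co}}$ is the closed convex hull (weak*-closed for subsets of $X^*$). Active index sets: $T_\varepsilon(x)=\{t\in T: f_t(x)\ge f(x)-\varepsilon\}$ for $\varepsilon\ge0$, and $T(x)=\{t\in T: f_t(x)=f(x)\}$. *)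

(* Defs.v *)
From HB Require Import structures.
From mathcomp Require Import all_boot all_order all_algebra.
From mathcomp Require Import all_classical all_reals all_analysis.

Set Implicit Arguments.
Unset Strict Implicit.
Unset Printing Implicit Defensive.

Import Order.TTheory GRing.Theory Num.Theory.
Import numFieldNormedType.Exports.

Local Open Scope classical_set_scope.
Local Open Scope ring_scope.

(* [(x + y)%dE] is the addition of [\bar R] with
   [(+oo + -oo)%dE = (-oo + +oo)%dE = +oo], whereas [(+oo + -oo)%E = -oo]. *)

Section topological_dual.
Context {R : realType} (X : tvsType R).

Definition lin_continuous : {pred X -> R^o} :=
  mem [set f : X -> R^o | linear f /\ continuous f].

Lemma lin_continuous_submod_closed : submod_closed lin_continuous.
Proof.
split.
  rewrite inE; split=> [a u v|]; first by rewrite /= scaler0 addr0.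
  exact: (@cst_continuous X R^o 0).
move=> a f g; rewrite !inE => -[lf cf] [lg cg]; split=> [b u v|u].
  rewrite /= !fctE lf lg !scalerDr !scalerA (mulrC a b) -!addrA.
  by congr (_ + _); rewrite addrCA.
apply: (@continuousD R R^o X (fun x => a *: f x) g); last exact: cg.
by apply: continuousZr; exact: cf.
Qed.

HB.instance Definition _ :=
  GRing.isSubmodClosed.Build R (X -> R^o) lin_continuous
    lin_continuous_submod_closed.

Record topdual := TopDual {
  topdual_fun :> X -> R^o ;
  topdual_funP : topdual_fun \in lin_continuous }.

HB.instance Definition _ := [isSub for topdual_fun].
HB.instance Definition _ := [Choice of topdual by <:].
HB.instance Definition _ := [SubChoice_isSubLmodule of topdual by <:].

(* the weak* topology: the one induced by pointwise convergence on [X] *)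
HB.instance Definition _ := Topological.copy topdual
  (initial_topology ((fun xs => xs) : topdual -> {ptws X -> R^o})).

End topological_dual.

Section convex_hull.
Context {R : realType} (V : preTopologicalLmodType R).

Definition convex_hull (A : set V) : set V := smallest (@convex_set R V) A.

Definition closed_convex_hull (A : set V) : set V := closure (convex_hull A).

End convex_hull.

Section extended_real_functions.
Context {R : realType}.
Local Open Scope ereal_scope.

Definition convex_efun (X : lmodType R) (phi : X -> \bar R) :=
  forall (x y : X) (l : R), (0 < l < 1)%R ->
    phi (l *: x + (1 - l) *: y)%R <= (l%:E * phi x + (1 - l)%:E * phi y)%dE.

Definition edom (X : Type) (phi : X -> \bar R) : set X := [set x | phi x < +oo].

Definition eindicator (X : Type) (A : set X) (x : X) : \bar R :=
  if x \in A then 0 else +oo.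

Definition esup_fun (T X : Type) (f_ : T -> X -> \bar R) (x : X) : \bar R :=
  ereal_sup (range (fun t => f_ t x)).

Definition lsc_envelope (X : topologicalType) (phi : X -> \bar R) (x : X) :
    \bar R :=
  ereal_sup [set g x | g in [set g : X -> \bar R |
    lower_semicontinuous g /\ forall y, g y <= phi y]].

Definition upper_semicontinuous (T : topologicalType) (g : T -> \bar R) :=
  forall t a, g t < a%:E -> exists2 V, nbhs t V & forall s, V s -> g s < a%:E.

Definition upper_semicontinuous_on (T : topologicalType) (A : set T)
    (g : T -> \bar R) :=
  @upper_semicontinuous (subspace A) g.

Definition subdifferential (X : tvsType R) (phi : X -> \bar R) (x : X) :
    set (topdual X) :=
  [set xs : topdual X | phi x \is a fin_num /\
    forall y, (xs (y - x)%R : R)%:E <= phi y - phi x].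

Definition eps_active (T X : Type) (f_ : T -> X -> \bar R) (eps : R) (x : X) :
    set T :=
  [set t | esup_fun f_ x - eps%:E <= f_ t x].

Definition active (T X : Type) (f_ : T -> X -> \bar R) (x : X) : set T :=
  [set t | f_ t x = esup_fun f_ x].

(* the linear subspace spanned by a finite family: the finite-dimensional linear
   subspaces are exactly the sets [lin_span s] with [s : seq X] *)
Definition lin_span (X : lmodType R) (s : seq X) : set X :=
  [set (\sum_(i < size s) c i *: s`_i)%R | c in [set: 'I_(size s) -> R]].

Definition fin_dim_subspaces_at (X : lmodType R) (x : X) : set (set X) :=
  [set L | (exists s : seq X, L = lin_span s) /\ L x].

End extended_real_functions.

(* Main.v *)
Require Import Defs.
From HB Require Import structures.
From mathcomp Require Import all_boot all_order all_algebra.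
From mathcomp Require Import all_classical all_reals all_analysis.
From mathcomp Require Import ring lra.

Set Implicit Arguments.
Unset Strict Implicit.
Unset Printing Implicit Defensive.

Import Order.TTheory GRing.Theory Num.Theory.
Import numFieldNormedType.Exports DualAddTheory.

Local Open Scope classical_set_scope.
Local Open Scope ring_scope.

(** The inclusion of the intersection in the subdifferential only uses, at each
    [y], the plane spanned by [x] and [y]: an element of the union for that plane
    satisfies the subgradient inequality of [f] at the single point [y], and this
    inequality defines a weak-star closed convex set. The union cannot be empty,
    as its closed convex hull is not, and this forces [f x] to be finite.

    For the converse, fix [xs] in the subdifferential of [f] at [x] and a
    subspace [L]. Since [topdual X] carries the weak-star topology, it is enough
    to bound support functions: for each [z] and each [d > 0], some subgradient
    [k] of some active [f_t + I_(L /\ dom f)] has [k z >= xs z - d]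
    ([closed_convex_hull_support]).

    - Compactness produces the active index ([active_index]). The affine minorant
      given by [xs] is also below [cl f = sup_t cl f_t], so for [y] in [dom f]
      and small [lam > 0] some index satisfies the tangent inequality at
      [x + lam (y - x)] up to [lam ^ 2]. By convexity such an index is nearly
      active at [x], and it satisfies the inequality at every larger step [mu] up
      to [mu lam]. Hence the sets of these indices shrink with [lam] inside a
      compact set, and a cluster point satisfies all the inequalities exactly
      by upper semicontinuity.
    - On a finite-dimensional [L] the convex set [D = L /\ dom f] has a relative
      interior. It is handled algebraically through a maximal family of directions
      [e_i] of [D - x] together with dual continuous functionals
      ([maximal_biorthogonal]): the sum of the [e_i] is a core direction
      ([core_sum]). Along a core direction the directional derivative of an
      active [f_t] dominates [xs], and a linear minorant attaining at least that
      value exists ([core_subgradient]).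
    - For an arbitrary [z], either [z] is a limit of core directions, and the
      previous point passes to the limit because all the subgradients are
      bounded above on the core direction by one constant; or a functional in the
      normal cone of [D] at [x] is positive at [z], and adding large multiples of
      it to any subgradient makes its value at [z] as large as desired
      ([core_or_normal]).

    All the separation arguments are instances of one form of the Hahn-Banach
    theorem, [cone_hahn_banach], about convex cones of pairs [(u, a)], each pair
    standing for the constraint [xi u <= a] on the functional sought. *)

(** * Hahn-Banach theorem for cones of linear constraints *)

Section cone_extension.
Context {R : realType} (V : lmodType R).

Definition convex_cone (E : set (V * R)) :=
  [/\ E (0, 0),
      forall u v a b, E (u, a) -> E (v, b) -> E (u + v, a + b) &
      forall s u a, 0 < s -> E (u, a) -> E (s *: u, s * a)].

Definition nonneg_at0 (E : set (V * R)) := forall a, E (0, a) -> 0 <= a.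

(** The empty chain has an empty union, which is not a cone; Zorn's lemma is
    therefore applied to the sets [A] such that [E `|` A] has the properties. *)
Lemma maximal_cone (E : set (V * R)) : convex_cone E -> nonneg_at0 E ->
  exists B, [/\ convex_cone B, nonneg_at0 B, E `<=` B &
    forall B', convex_cone B' -> nonneg_at0 B' -> B `<=` B' -> B' `<=` B].
Proof.
move=> cE pE.
have [|A [[cA pA] Amax]] := @Zorn_bigcup _
    [set A | convex_cone (E `|` A) /\ nonneg_at0 (E `|` A)].
  move=> F FP Ftot.
  have both p q : (E `|` \bigcup_(X in F) X) p -> (E `|` \bigcup_(X in F) X) q ->
      exists A, [/\ convex_cone (E `|` A), E `|` A `<=` E `|` \bigcup_(X in F) X,
                    (E `|` A) p & (E `|` A) q].
    have sub A : F A -> E `|` A `<=` E `|` \bigcup_(X in F) X.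
      by move=> FA; apply: setUS; exact: bigcup_sup.
    move=> [Ep|[A FA Ap]] [Eq|[B FB Bq]].
    - by exists set0; rewrite setU0; split=> // x Ex; left.
    - by exists B; split; [exact: (FP _ FB).1|exact: sub|left|right].
    - by exists A; split; [exact: (FP _ FA).1|exact: sub|right|left].
    - have [AB|BA] := Ftot _ _ FA FB.
        exists B; split; [exact: (FP _ FB).1|exact: sub| |by right].
        by right; exact: AB.
      exists A; split; [exact: (FP _ FA).1|exact: sub|by right|].
      by right; exact: BA.
  split; last first.
    move=> a [/pE//|[A FA Aa]]; apply: (FP _ FA).2; by right.
  split.
  - by left; case: cE.
  - move=> u v a b ua vb; have [A [[_ addA _] AU Aua Avb]] := both _ _ ua vb.
    by apply: AU; exact: addA.
  - move=> s u a s0 ua; have [A [[_ _ scA] AU Aua _]] := both _ _ ua ua.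
    by apply: AU; exact: scA.
exists (E `|` A); split; [exact: cA|exact: pA|exact: subsetUl|].
move=> B' cB' pB' AB'.
have [<-|nAB'] := pselect (A = B'); first exact: subsetUr.
have EB' : E `|` B' = B'.
  by apply/setUidPr => x Ex; apply: AB'; left.
exfalso; apply: (Amax B'); last by rewrite /= EB'.
split; first by move=> x Ax; apply: AB'; right.
move=> B'A; apply: nAB'; apply/seteqP; split=> // x Ax.
by apply: AB'; right.
Qed.

(** The least bound [q u] that a maximal cone puts on [u] is attained and odd:
    [(- u, - q u)] can be added to the cone without creating a negative pair above
    [0], hence belongs to it by maximality. A sublinear odd function is linear. *)
Lemma cone_hahn_banach (E : set (V * R)) : convex_cone E -> nonneg_at0 E ->
    (forall u, exists a, E (u, a)) ->
  exists xi : {linear V -> R^o}, forall u a, E (u, a) -> xi u <= a.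
Proof.
move=> cE pE totE.
have [B [[B0 addB scB] pB EB Bmax]] := maximal_cone cE pE.
have totB u : [set a | B (u, a)] !=set0.
  by have [a Ea] := totE u; exists a; exact: EB.
pose q u : R := inf [set a | B (u, a)].
have lbB u : has_lbound [set a | B (u, a)].
  have [b Bb] := totB (- u); exists (- b) => a Ba.
  by rewrite -subr_ge0 opprK; apply: pB; rewrite -(subrr u); exact: addB.
have q_le u a : B (u, a) -> q u <= a by move=> Ba; exact: ge_inf.
have BN u : B (- u, - q u).
  pose B1 := [set p | exists k v b,
    [/\ 0 <= k, B (v, b) & p = (v - k *: u, b - k * q u)]].
  suff /(_ (- u, - q u)) : B1 `<=` B.
    by apply; exists 1, 0, 0; split=> //; rewrite scale1r mul1r !sub0r.
  apply: Bmax.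
  - split.
    + by exists 0, 0, 0; split=> //; rewrite scale0r mul0r !subr0.
    + move=> _ _ _ _ [k [v [b [k0 Bvb [-> ->]]]]] [l [w [c [l0 Bwc [-> ->]]]]].
      exists (k + l), (v + w), (b + c); split; [exact: addr_ge0|exact: addB|].
      by congr pair; rewrite ?scalerDl ?mulrDl opprD addrACA.
    + move=> s _ _ s0 [k [v [b [k0 Bvb [-> ->]]]]].
      exists (s * k), (s *: v), (s * b); split.
      * by rewrite mulr_ge0// ltW.
      * exact: scB.
      * by rewrite scalerBr mulrBr scalerA mulrA.
  - move=> a [k [v [b [k0 Bvb [/esym/eqP]]]]].
    rewrite subr_eq0 => /eqP vE ->; rewrite subr_ge0.
    move: k0; rewrite le_eqVlt => /predU1P[k0|k0].
      by rewrite -k0 mul0r; apply: pB; rewrite vE -k0 scale0r in Bvb.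
    rewrite -ler_pdivlMl//; apply: q_le.
    have := scB k^-1 _ _ _ Bvb; rewrite vE scalerA mulVf ?gt_eqF// scale1r.
    by apply; rewrite invr_gt0.
  - by move=> [v b] Bvb; exists 0, v, b; rewrite scale0r mul0r !subr0.
have qN u : q (- u) = - q u.
  apply/eqP; rewrite eq_le q_le//=; apply: lb_le_inf => // b Bb.
  rewrite lerNl; apply: lb_le_inf => // a Ba; rewrite lerNl -subr_ge0 opprK.
  by apply: pB; rewrite -(addNr u); exact: addB.
have Bq u : B (u, q u) by have := BN (- u); rewrite opprK qN opprK.
have qD_le u v : q (u + v) <= q u + q v by apply: q_le; exact: addB.
have qD u v : q (u + v) = q u + q v.
  apply/eqP; rewrite eq_le qD_le/= -lerN2 -qN !opprD -!qN; exact: qD_le.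
have qZ_le s u : 0 < s -> q (s *: u) <= s * q u.
  by move=> s0; apply: q_le; exact: scB.
have qZ_gt0 s u : 0 < s -> q (s *: u) = s * q u.
  move=> s0; apply/eqP; rewrite eq_le qZ_le//= -ler_pdivlMl//.
  have := qZ_le s^-1 (s *: u); rewrite scalerA mulVf ?gt_eqF// scale1r.
  by apply; rewrite invr_gt0.
have q0 : q 0 = 0.
  by apply: (@addrI _ (q 0)); rewrite -qD !addr0.
have qZ s u : q (s *: u) = s * q u.
  have [s0|s0|->] := ltgtP s 0; last by rewrite scale0r mul0r.
    by rewrite -[s]opprK scaleNr qN qZ_gt0 ?oppr_gt0// [in RHS]mulNr.
  exact: qZ_gt0.
have lq : linear (q : V -> R^o) by move=> a u v; rewrite qD qZ.
pose qL := GRing.isLinear.Build R V R^o *:%R q lq.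
pose Q : {linear V -> R^o} := HB.pack (q : V -> R^o) qL.
by exists Q => u a /EB; exact: q_le.
Qed.

End cone_extension.

(** * Convex sets *)

Section convex_sets.
Context {R : realType} (V : lmodType R).

Lemma convex_setP (A : set V) : @convex_set R V A <->
  forall x y l, 0 < l < 1 -> A x -> A y -> A (l *: x + (1 - l) *: y).
Proof.
split=> [cA x y l /andP[l0 l1] Ax Ay|cA].
  have /= := cA x y (Itv01 (ltW l0) (ltW l1)).
  by rewrite !inE; exact.
apply/convex_setW => x y /set_mem Ax /set_mem Ay k k0 k1; rewrite inE.
by apply: cA => //; rewrite k0.
Qed.

Lemma convex_setD (A : set V) x y s t : @convex_set R V A -> A x -> A y ->
  0 <= s -> 0 <= t -> exists2 z, A z & s *: x + t *: y = (s + t) *: z.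
Proof.
move=> /convex_setP cA Ax Ay; rewrite le_eqVlt => /predU1P[<-|s0].
  by move=> _; exists y; rewrite // scale0r !add0r.
rewrite le_eqVlt => /predU1P[<-|t0].
  by exists x; rewrite // scale0r !addr0.
have st0 : 0 < s + t by rewrite addr_gt0.
exists (s / (s + t) *: x + (1 - s / (s + t)) *: y).
  by apply: cA => //; rewrite divr_gt0//= ltr_pdivrMr// mul1r ltrDl.
rewrite scalerDr !scalerA mulrBr mulr1 mulrCA divff ?gt_eqF// mulr1.
by rewrite [s + t]addrC addrK.
Qed.

End convex_sets.

(** * Continuous linear functionals *)

Section continuous_functionals.
Context {R : realType} (X : tvsType R).

(** Both [(y - x) / e] and its opposite are in [U] when [y] is close to [x]. *)
Lemma linear_continuous_nbhs0 (U : set X) (xi : {linear X -> R^o}) :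
  nbhs 0 U -> (forall u, U u -> xi u <= 1) -> continuous xi.
Proof.
move=> U0 xiU x.
have shift c : c *: (y - x) @[y --> x] --> (0 : X).
  suff : c *: (y - x) @[y --> x] --> c *: (x - x) by rewrite subrr scaler0.
  apply: (@continuous2_cvg _ _ _ _ _ _ (fun=> c : R^o) (fun y => y - x)
    (fun a b => a *: b) c (x - x)).
  - exact: (@scale_continuous R X (c, x - x)).
  - exact: cvg_cst.
  apply: (@continuous2_cvg _ _ _ _ _ _ id (fun=> - x) (fun a b => a + b) x (- x)).
  - exact: (@add_continuous X (x, - x)).
  - exact: cvg_id.
  - exact: cvg_cst.
apply/cvgrPdist_le => e e0.
have /(_ _ U0) up := shift e^-1.
have /(_ _ U0) dn := shift (- e^-1).
near=> y.
have yE : y - x = e *: (e^-1 *: (y - x)) by rewrite scalerA divff ?gt_eqF// scale1r.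
rewrite distrC -linearB yE linearZ /= normrM (gtr0_norm e0).
rewrite -[leRHS]mulr1 ler_pM2l// ler_norml; apply/andP; split.
  rewrite lerNl -linearN -scaleNr; apply: xiU.
  by near: y; exact: dn.
by apply: xiU; near: y; exact: up.
Unshelve. all: by end_near. Qed.

Lemma nbhs0_absorbing (U : set X) u : nbhs 0 U ->
  exists s v, [/\ 0 <= s, U v & u = s *: v].
Proof.
move=> U0.
have : (fun k : R^o => k *: u) @ 0 --> (0 : X).
  suff : (fun k : R^o => k *: u) @ 0 --> 0 *: u by rewrite scale0r.
  apply: (@continuous2_cvg _ _ _ _ _ _ id (fun=> u) (fun (a : R^o) b => a *: b) 0 u).
  - exact: (@scale_continuous R X (0, u)).
  - exact: cvg_id.
  - exact: cvg_cst.
move=> /(_ _ U0) [e /= e0 eU].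
exists ((e / 2)^-1), ((e / 2) *: u); split.
- by rewrite invr_ge0 divr_ge0// ltW.
- apply: eU => /=; rewrite sub0r normrN gtr0_norm ?divr_gt0//.
  by rewrite ltr_pdivrMr// ltr_pMr// ltr1n.
- by rewrite scalerA mulVf ?scale1r// mulf_neq0 ?gt_eqF.
Qed.

(** The constraints are [xi <= 1] on a convex neighbourhood [U] of [0] that misses
    [e], which makes [xi] continuous, and [xi (- e) <= -1]. *)
Lemma functional_separating (e : X) : hausdorff_space X -> e != 0 ->
  exists phi : topdual X, phi e = 1.
Proof.
move=> hX e0; have e0' : (0 : X) != e by rewrite eq_sym.
have [A [oA]] := hausdorff_accessible hX e0'; rewrite !inE => A0 Ae.
have [B cB [oB /(_ 0)]] := @locally_convex R X.
move=> /(_ A) /=; rewrite nbhsE => -[]; first by exists A.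
move=> U [BU U0] UA.
have {}cU : @convex_set R X U by apply: cB; rewrite inE.
have nU : nbhs 0 U by apply: open_nbhs_nbhs; split; [exact: oB|].
have Ue : ~ U e by move/UA.
pose E := [set p : X * R | exists s k v,
  [/\ 0 <= s, U v, p.1 + k *: e = s *: v & p.2 = s - k]].
have [|||xi xiE] := @cone_hahn_banach R X E.
- split.
  + by exists 0, 0, 0; rewrite /= !scale0r add0r subr0.
  + move=> u1 u2 a b [s [k [v [/= s0 Uv uE ->]]]] [t [l [w [/= t0 Uw wE ->]]]].
    have [z Uz zE] := convex_setD cU Uv Uw s0 t0.
    exists (s + t), (k + l), z; split=> //=; first exact: addr_ge0.
      by rewrite scalerDl addrACA uE wE.
    by rewrite opprD addrACA.
  + move=> t u a t0 [s [k [v [/= s0 Uv uE ->]]]].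
    exists (t * s), (t * k), v; split=> //=.
    * by rewrite mulr_ge0// ltW.
    * by rewrite -!scalerA -scalerDr uE.
    * by rewrite mulrBr.
- move=> a [s [k [v [/= s0 Uv]]]]; rewrite add0r => kesv ->.
  rewrite subr_ge0 leNgt; apply/negP => sk; apply: Ue.
  have k0 : 0 < k by exact: le_lt_trans sk.
  have -> : e = (s / k) *: v + (1 - s / k) *: 0.
    by rewrite scaler0 addr0 mulrC -scalerA -kesv scalerA mulVf ?scale1r// gt_eqF.
  move: s0; rewrite le_eqVlt => /predU1P[<-|s0].
    by rewrite mul0r scale0r scaler0 addr0.
  move/convex_setP : cU; apply => //.
  by rewrite divr_gt0//= ltr_pdivrMr// mul1r.
- move=> u; have [s [v [s0 Uv ->]]] := nbhs0_absorbing u nU.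
  by exists s, s, 0, v; split=> //=; rewrite ?scale0r ?addr0 ?subr0.
have xi_cont : continuous xi.
  apply: (linear_continuous_nbhs0 nU) => u Uu; apply: xiE.
  by exists 1, 0, u; split=> //=; rewrite ?scale0r ?scale1r ?addr0 ?subr0.
have xie : 1 <= xi e.
  rewrite -lerN2 -linearN; apply: xiE.
  by exists 0, 1, 0; split=> //=; rewrite ?scale1r ?scale0r ?addNr// sub0r.
have xi_dual : (xi : X -> R^o) \in @lin_continuous R X.
  by rewrite inE; split=> //; exact: linearP.
exists ((xi e)^-1 *: TopDual xi_dual) => /=.
by rewrite [LHS]mulVf// gt_eqF// (lt_le_trans _ xie).
Qed.

End continuous_functionals.

Section topdual_theory.
Context {R : realType} (X : tvsType R).
Implicit Types phi : topdual X.

Lemma topdual_linear phi : linear phi.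
Proof. by have := topdual_funP phi; rewrite inE => -[]. Qed.

HB.instance Definition _ phi :=
  GRing.isLinear.Build R X R^o *:%R (topdual_fun phi) (topdual_linear phi).

Lemma topdualZ phi c v : phi (c *: v) = c * phi v :> R.
Proof. by rewrite linearZ. Qed.

Lemma topdual_sumE n (c : 'I_n -> R) (phi : 'I_n -> topdual X) v :
  (\sum_i c i *: phi i) v = \sum_i c i * phi i v :> R.
Proof.
elim/big_ind2 : _ => // a f b g.
by move=> /= <- <-.
Qed.

End topdual_theory.

(** * Biorthogonal systems *)

Section biorthogonal_systems.
Context {R : realType} (X : tvsType R) (hX : hausdorff_space X).

Definition biorthogonal n (e : 'I_n -> X) (phi : 'I_n -> topdual X) :=
  forall i j, phi i (e j) = (i == j)%:R.

Definition coord_proj n (e : 'I_n -> X) (phi : 'I_n -> topdual X) (u : X) : X :=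
  \sum_i (phi i u : R) *: e i.

(** A functional equal to [1] at the nonzero vector [u - coord_proj e phi u],
    corrected by a combination of the [phi i]. *)
Lemma biorthogonal_annihilator n (e : 'I_n -> X) (phi : 'I_n -> topdual X) u :
  biorthogonal e phi -> u <> coord_proj e phi u ->
  exists psi : topdual X, (forall i, psi (e i) = 0) /\ psi u = 1.
Proof.
move=> bio /eqP; rewrite -subr_eq0 => /(functional_separating hX)[psi psiu].
exists (psi - \sum_i (psi (e i) : R) *: phi i).
have psiE v : (psi - \sum_i (psi (e i) : R) *: phi i) v =
    psi v - \sum_i psi (e i) * phi i v :> R by rewrite -topdual_sumE.
split=> [j|].
  rewrite psiE (bigD1 j)//= bio eqxx mulr1 big1 ?addr0 ?subrr// => i ij.
  by rewrite bio (negbTE ij) mulr0.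
rewrite psiE -psiu linearB.
have -> // : \sum_i psi (e i) * phi i u = psi (coord_proj e phi u) :> R.
by rewrite linear_sum; apply: eq_bigr => i _; rewrite linearZ mulrC.
Qed.

Lemma biorthogonal_extend n (e : 'I_n -> X) (phi : 'I_n -> topdual X) u :
  biorthogonal e phi -> u <> coord_proj e phi u ->
  exists psi, @biorthogonal n.+1
    (fun i => if unlift ord0 i is Some j then e j else u) psi.
Proof.
move=> bio /(biorthogonal_annihilator bio)[psi [psie psiu]].
exists (fun i => if unlift ord0 i is Some j then phi j - (phi j u : R) *: psi
                 else psi) => i j.
case: (unliftP ord0 i) => [i'|] ->; case: (unliftP ord0 j) => [j'|] ->.
- rewrite (inj_eq lift_inj) -bio -[LHS]/(phi i' (e j') - phi i' u * psi (e j') : R).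
  by rewrite psie mulr0 subr0.
- rewrite eq_sym (negbTE (neq_lift _ _)).
  rewrite -[LHS]/(phi i' u - phi i' u * psi u : R).
  by rewrite psiu mulr1 subrr.
- by rewrite psie (negbTE (neq_lift _ _)).
- by rewrite psiu eqxx.
Qed.

(** The identity matrix of size [n] factors through the matrix of the coordinates
    of the [e i] on [s]. *)
Lemma biorthogonal_le_size n (e : 'I_n -> X) (phi : 'I_n -> topdual X) s :
  biorthogonal e phi -> (forall i, lin_span s (e i)) -> (n <= size s)%N.
Proof.
move=> bio es.
have /choice[c cE] : forall i, exists c : 'I_(size s) -> R,
    \sum_k c k *: s`_k = e i by move=> i; have [c _ <-] := es i; exists c.
pose A := \matrix_(i < n, k < size s) (phi i s`_k : R).
pose B := \matrix_(k < size s, j < n) c j k.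
apply: (@mulmx1_min R _ _ A B); apply/matrixP => i j.
rewrite !mxE -bio -cE linear_sum; apply: eq_bigr => k _.
by rewrite !mxE linearZ mulrC.
Qed.

(** The spanning sequence bounds the length of the systems, so that extending
    them stops, and then all of [S] lies in the span of some of its own
    elements. *)
Lemma maximal_biorthogonal (S : set X) s : S `<=` lin_span s ->
  exists n (e : 'I_n -> X) (phi : 'I_n -> topdual X),
    [/\ biorthogonal e phi, forall i, S (e i) &
        forall u, S u -> u = coord_proj e phi u].
Proof.
move=> Ss; apply: contrapT => nomax.
have sys n : exists (e : 'I_n -> X) (phi : 'I_n -> topdual X),
    biorthogonal e phi /\ forall i, S (e i).
  elim: n => [|n [e [phi [bio Se]]]].
    by exists (fun=> 0), (fun=> 0); split=> -[].
  have [u Su uE] : exists2 u, S u & u <> coord_proj e phi u.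
    apply: contrapT => nou; apply: nomax; exists n, e, phi; split=> // u Su.
    by apply: contrapT => uE; apply: nou; exists u.
  have [psi bio'] := biorthogonal_extend bio uE.
  exists (fun i => if unlift ord0 i is Some j then e j else u), psi; split=> // i.
  by case: unliftP.
have [e [phi [bio Se]]] := sys (size s).+1.
by have := biorthogonal_le_size bio (fun i => Ss _ (Se i)); rewrite ltnn.
Qed.

End biorthogonal_systems.

(** * Convexity through the epigraph *)

Section epigraph_convexity.
Context {R : realType}.
Local Open Scope ereal_scope.

Lemma lt_EFin_between (x : \bar R) (a : R) : x < a%:E ->
  exists2 v : R, (v < a)%R & x < v%:E.
Proof.
case: x => [r| |]// ra; last by exists (a - 1)%R; rewrite ?ltNyr// ltrBlDr ltrDl.
by exists ((r + a) / 2)%R; rewrite ?lte_fin midf_lt.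
Qed.

Lemma lt_pinfty_le_EFin (x : \bar R) : x < +oo -> exists r : R, x <= r%:E.
Proof. by case: x => [r| |]// _; [exists r|exists 0%R; rewrite leNye]. Qed.

Context (X : lmodType R).

(** Equivalent to [convex_efun], but with real bounds only, which avoids all the
    conventions on infinite values. *)
Definition epi_convex (phi : X -> \bar R) := forall x y l a b, (0 < l < 1)%R ->
  phi x <= a%:E -> phi y <= b%:E ->
  phi (l *: x + (1 - l) *: y)%R <= (l * a + (1 - l) * b)%:E.

Lemma convex_efun_epi (phi : X -> \bar R) : convex_efun phi -> epi_convex phi.
Proof.
move=> cphi x y l a b /[dup] l01 /andP[l0 l1] xa yb.
apply: (le_trans (cphi x y l l01)); have l1' : (0 < 1 - l)%R by rewrite subr_gt0.
case: (phi x) xa => [r| |]// xa; case: (phi y) yb => [s| |]// yb.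
- by rewrite -!EFinM -[(_ + _)%dE]/((l * r + (1 - l) * s)%R%:E) lee_fin lerD// ler_pM2l// -lee_fin.
- by rewrite mulrNy gtr0_sg// mul1e leNye.
- by rewrite mulrNy gtr0_sg// mul1e leNye.
- by rewrite (@gt0_muleNy _ l%:E)// (@gt0_muleNy _ (1 - l)%:E)// leNye.
Qed.

Lemma epi_convex_lt (phi : X -> \bar R) x y l a b : epi_convex phi ->
  (0 < l < 1)%R -> phi x < a%:E -> phi y <= b%:E ->
  phi (l *: x + (1 - l) *: y)%R < (l * a + (1 - l) * b)%:E.
Proof.
move=> cphi /[dup] l01 /andP[l0 _] /lt_EFin_between[v va /ltW xv] yb.
apply: le_lt_trans (cphi _ _ _ _ _ l01 xv yb) _.
by rewrite lte_fin ltrD2r ltr_pM2l.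
Qed.

Lemma epi_convex_esup T (f_ : T -> X -> \bar R) :
  (forall t, epi_convex (f_ t)) -> epi_convex (esup_fun f_).
Proof.
move=> cf x y l a b l01 xa yb; apply: ge_ereal_sup => _ [t _ <-].
apply: cf => //; [apply: le_trans xa|apply: le_trans yb];
  by apply: ereal_sup_ubound; exists t.
Qed.

End epigraph_convexity.

(** * Lower semicontinuous envelopes *)

Section lsc_envelopes.
Context {R : realType}.
Local Open Scope ereal_scope.

Lemma lsc_envelope_le (X : topologicalType) (phi : X -> \bar R) x :
  lsc_envelope phi x <= phi x.
Proof. by apply: ge_ereal_sup => _ [g [_ gphi] <-]. Qed.

Lemma lsc_envelope_max (X : topologicalType) (phi g : X -> \bar R) x :
  lower_semicontinuous g -> (forall y, g y <= phi y) ->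
  g x <= lsc_envelope phi x.
Proof. by move=> gl gphi; apply: ereal_sup_ubound; exists g. Qed.

Lemma lsc_envelope_lsc (X : topologicalType) (phi : X -> \bar R) :
  lower_semicontinuous (lsc_envelope phi).
Proof.
move=> x a /ereal_sup_gt[_ [g [gl gphi] <-]] /gl[V Vx Vg].
exists V => // y /Vg ag; apply: lt_le_trans ag _; exact: lsc_envelope_max.
Qed.

(** Otherwise the function equal to [a] on an open set where [a <= phi], and to
    [-oo] elsewhere, would be a larger lower semicontinuous minorant. *)
Lemma lsc_envelope_nbhs (X : topologicalType) (phi : X -> \bar R) x a U :
  lsc_envelope phi x < a%:E -> nbhs x U -> exists2 y, U y & phi y < a%:E.
Proof.
move=> xa; rewrite nbhsE => -[W [oW Wx] WU]; apply: contrapT => noy.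
move: xa; rewrite ltNge => /negP; apply.
pose g y : \bar R := if y \in W then a%:E else -oo.
have -> : a%:E = g x by rewrite /g mem_set.
apply: lsc_envelope_max => [y b|y]; rewrite /g; case: ifPn => [/set_mem Wy|_].
- move=> ba; exists W; first by apply: open_nbhs_nbhs; split.
  by move=> u Wu; rewrite mem_set.
- by rewrite ltNge leNye.
- by rewrite leNgt; apply/negP => ya; apply: noy; exists y => //; exact: WU.
- by rewrite leNye.
Qed.

(** If the envelope exceeded [c > l a + (1 - l) b] at the convex combination, it
    would do so nearby; but points where [phi] is almost below [a] and [b] exist
    arbitrarily close to [x] and [y], and [phi] is below [c] at their
    combination. *)
Lemma epi_convex_lsc_envelope (X : tvsType R) (phi : X -> \bar R) :
  epi_convex phi -> epi_convex (lsc_envelope phi).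
Proof.
move=> cphi x y l a b l01 xa yb; rewrite leNgt; apply/negP => ab.
have [c] : exists2 c, (l * a + (1 - l) * b < c)%R &
    c%:E < lsc_envelope phi (l *: x + (1 - l) *: y)%R.
  case: (lsc_envelope _ _) ab => [r| |]// ab.
    by exists ((l * a + (1 - l) * b + r) / 2)%R; rewrite ?lte_fin midf_lt.
  by exists (l * a + (1 - l) * b + 1)%R; rewrite ?ltry// ltrDl.
move=> abc /lsc_envelope_lsc[V Vxy Vc].
pose d := (c - (l * a + (1 - l) * b))%R.
have d0 : (0 < d)%R by rewrite subr_gt0.
have near_lt z r : lsc_envelope phi z <= r%:E -> lsc_envelope phi z < (r + d)%:E.
  by move=> /le_lt_trans; apply; rewrite lte_fin ltrDl.
have comb : (l *: z.1 + (1 - l) *: z.2)%R @[z --> (x, y)] -->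
    (l *: x + (1 - l) *: y)%R.
  apply: (@continuous2_cvg _ _ _ _ _ _ (fun z : X * X => l *: z.1)%R
    (fun z : X * X => (1 - l) *: z.2)%R (fun u v => u + v)%R).
  - exact: (@add_continuous X (l *: x, (1 - l) *: y)%R).
  - apply: (@continuous2_cvg _ _ _ _ _ _ (fun=> l : R^o) fst
      (fun (k : R^o) u => k *: u)%R).
    + exact: (@scale_continuous R X (l, x)).
    + exact: cvg_cst.
    + exact: cvg_fst.
  - apply: (@continuous2_cvg _ _ _ _ _ _ (fun=> (1 - l)%R : R^o) snd
      (fun (k : R^o) u => k *: u)%R).
    + exact: (@scale_continuous R X ((1 - l)%R, y)).
    + exact: cvg_cst.
    + exact: cvg_snd.
have [[U W] /= [Ux Wy] UWV] := comb _ Vxy.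
have [x' Ux' x'a] := lsc_envelope_nbhs (near_lt _ _ xa) Ux.
have [y' Wy' y'b] := lsc_envelope_nbhs (near_lt _ _ yb) Wy.
have /Vc := UWV (x', y') (conj Ux' Wy'); apply/negP; rewrite -leNgt.
apply: (le_trans (lsc_envelope_le _ _)).
apply: (le_trans (cphi _ _ _ _ _ l01 (ltW x'a) (ltW y'b))).
by rewrite lee_fin /d; lra.
Qed.

End lsc_envelopes.

(** * An active index along a segment *)

Section active_index.
Context {R : realType} (T : topologicalType) (X : lmodType R).
Variables (h : T -> X -> \bar R) (A : set T) (x y : X) (a b c eps : R).
Hypotheses (hconv : forall t, epi_convex (h t)).
Hypotheses (hx : forall t, (h t x <= a%:E)%E) (hy : forall t, (h t y <= b%:E)%E).
Hypotheses (cA : compact A) (eps0 : 0 < eps).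
Hypothesis (hA : forall t, ((a - eps)%:E <= h t x)%E -> A t).

Let z (mu : R) := mu *: y + (1 - mu) *: x.

Hypothesis (husc : forall mu, 0 < mu <= 1 ->
  upper_semicontinuous_on A (fun t => h t (z mu))).
Hypothesis (hsup : forall mu, 0 < mu <= 1 ->
  ((a + mu * c)%:E <= esup_fun h (z mu))%E).

(** The square makes the sets decrease with [lam]: by convexity an error
    [lam ^+ 2] at [lam] becomes at most [mu * lam] at [mu >= lam]. *)
Let B lam := [set t | A t /\ ((a + lam * c - lam ^+ 2)%:E <= h t (z lam))%E].

Let B_slope lam mu t : 0 < lam <= mu -> mu <= 1 -> B lam t ->
  ((a + mu * c - mu * lam)%:E <= h t (z mu))%E.
Proof.
move=> /andP[lam0]; rewrite le_eqVlt => /predU1P[<-|lammu] mu1 [_ hlam].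
  by rewrite -expr2.
have mu0 : 0 < mu by exact: lt_trans lammu.
rewrite leNgt; apply/negP => hmu.
have l01 : 0 < lam / mu < 1 by rewrite divr_gt0//= ltr_pdivrMr// mul1r.
have := epi_convex_lt (@hconv t) l01 hmu (hx t).
have -> : (lam / mu) *: z mu + (1 - lam / mu) *: x = z lam.
  rewrite /z scalerDr !scalerA -addrA -scalerDl; congr (_ *: _ + _ *: _);
    by field; rewrite gt_eqF.
apply/negP; rewrite -leNgt; apply: le_trans hlam; rewrite lee_fin.
have -> // : lam / mu * (a + mu * c - mu * lam) + (1 - lam / mu) * a =
  a + lam * c - lam ^+ 2 by field; rewrite gt_eqF.
Qed.

(** Convexity bounds [h t (z lam)] by [lam * b + (1 - lam) * h t x], so for
    [lam <= 1] with [lam * K <= eps] an index almost reaching the supremum at [z lam] is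
    [eps]-active at [x]. *)
Let K := `|b - a + eps - c| + 1.
Let lam0 := Num.min 1 (eps / K).

Let K_gt0 : 0 < K. Proof. by rewrite ltr_wpDl. Qed.

Let lam0_gt0 : 0 < lam0.
Proof. by rewrite lt_min ltr01 divr_gt0. Qed.

Let B_neq0 lam : 0 < lam <= lam0 -> B lam !=set0.
Proof.
move=> /andP[l0]; rewrite le_min => /andP[l1 leps].
have lsup : ((a + lam * c - lam ^+ 2)%:E < esup_fun h (z lam))%E.
  apply: lt_le_trans (hsup _); rewrite ?l0// lte_fin.
  by rewrite ltrBlDr ltrDl exprn_gt0.
have [_ [t _ <-] ht] := ereal_sup_gt lsup.
exists t; split; last exact: ltW.
apply: hA; rewrite leNgt; apply/negP => htx.
have leK : lam * (b - a + eps - c + lam) <= eps.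
  rewrite -ler_pdivlMl// mulrC; apply: le_trans (_ : K <= _).
    by rewrite lerD// ler_norm.
  by rewrite ler_pdivlMr// mulrC -ler_pdivlMr.
have : (h t (z lam) <= (lam * b + (1 - lam) * (a - eps))%:E)%E.
  move: l1; rewrite le_eqVlt => /predU1P[->|l1].
    by rewrite /z subrr scale0r mul0r !addr0 scale1r mul1r.
  by apply: hconv; rewrite ?l0//; exact: ltW.
apply/negP; rewrite -ltNge; apply: le_lt_trans ht; rewrite lee_fin.
rewrite -subr_ge0; move: leK; rewrite -subr_ge0.
have -> // : a + lam * c - lam ^+ 2 - (lam * b + (1 - lam) * (a - eps)) =
  eps - lam * (b - a + eps - c + lam) by ring.
Qed.

(** A cluster point [t] of the sets [B lam] as [lam] tends to [0] satisfies the
    inequalities for [0 < mu] by upper semicontinuity. The one at [x] follows by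
    convexity between [x] and [y], letting [mu] tend to [0]. *)
Lemma active_index : exists t, [/\ (a%:E <= h t x)%E &
  forall mu, 0 < mu <= 1 -> ((a + mu * c)%:E <= h t (z mu))%E].
Proof.
pose F := filter_from [set lam | 0 < lam <= lam0] B.
have FF : ProperFilter F.
  apply: filter_from_proper; last exact: B_neq0.
  apply: filter_from_filter; first by exists lam0; rewrite /= lexx lam0_gt0.
  move=> l1 l2 /= /andP[l10 l1l] /andP[l20 l2l].
  have sub l l' : 0 < l <= l' -> l' <= lam0 -> B l `<=` B l'.
    move=> ll'; rewrite le_min => /andP[l'1 _] t Bt.
    split; first exact: Bt.1.
    have /andP[lgt0 lel'] := ll'.
    apply: le_trans (B_slope _ l'1 Bt); last by [].
    by rewrite lee_fin lerD2l lerN2 expr2 ler_pM2l// (lt_le_trans lgt0).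
  exists (Num.min l1 l2); first by rewrite /= lt_min l10 l20/= ge_min l1l.
  by rewrite subsetI; split; apply: sub => //; rewrite lt_min l10 l20/= ge_min lexx ?orbT.
have [|t [At clt]] := cA FF.
  by exists lam0 => [|t []//]; rewrite /= lexx lam0_gt0.
have slope mu : 0 < mu <= 1 -> ((a + mu * c)%:E <= h t (z mu))%E.
  move=> /[dup] mu01 /andP[mu0 mu1]; rewrite leNgt; apply/negP.
  move=> /lt_EFin_between[v vlt /(husc mu01)[V]].
  rewrite /nbhs/= -nbhs_subspace_in// => Vt Vv.
  pose lam := Num.min lam0 (Num.min mu ((a + mu * c - v) / mu)).
  have lam_gt0 : 0 < lam by rewrite lt_min lam0_gt0 lt_min mu0 divr_gt0// subr_gt0.
  have : lam <= Num.min mu ((a + mu * c - v) / mu) by rewrite ge_min lexx orbT.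
  rewrite le_min => /andP[lammu lamq].
  have [|s [Bs /(_ Bs.1)/Vv]] := clt (B lam) _ _ Vt.
    by exists lam => //=; rewrite lam_gt0 ge_min lexx.
  apply/negP; rewrite -leNgt; apply: le_trans (B_slope _ mu1 Bs).
    by rewrite lee_fin lerBrDr addrC -lerBrDr mulrC -ler_pdivlMr.
  by rewrite lam_gt0.
exists t; split=> //; rewrite leNgt; apply/negP => /lt_EFin_between[v va hv].
(* small enough for [mu * (b - v - c)] to stay below the gap [a - v] *)
pose mu := Num.min (1 / 2) ((a - v) / (`|b - v - c| + 1)).
have mu0 : 0 < mu.
  by rewrite lt_min divr_gt0//= divr_gt0// ?subr_gt0// ltr_wpDl.
have mu1 : mu < 1.
  by apply: (@le_lt_trans _ _ (1/2)); [rewrite ge_min lexx|lra].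
have : (a + mu * c <= mu * b + (1 - mu) * v).
  rewrite -lee_fin; apply: le_trans (slope _ _) _; first by rewrite mu0 ltW.
  by apply: hconv; rewrite ?mu0//; exact: ltW.
apply/negP; rewrite -ltNge -subr_gt0.
have -> : a + mu * c - (mu * b + (1 - mu) * v) = a - v - mu * (b - v - c) by ring.
rewrite subr_gt0; apply: (@lt_le_trans _ _ (mu * (`|b - v - c| + 1))).
  by rewrite ltr_pM2l// (le_lt_trans (ler_norm _))// ltrDl.
by rewrite -ler_pdivlMr ?ltr_wpDl// ge_min lexx orbT.
Qed.

End active_index.

(** * Feasible directions and relative interior *)

Section feasible_directions.
Context {R : realType} (X : lmodType R).
Variables (D : set X) (x : X).
Hypotheses (cD : @convex_set R X D) (Dx : D x).

Definition feasible_directions : set X :=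
  [set u | exists k y, [/\ 0 <= k, D y & u = k *: (y - x)]].

Lemma feasible_directions0 : feasible_directions 0.
Proof. by exists 0, x; rewrite scale0r. Qed.

Lemma feasible_directionsD u v : feasible_directions u ->
  feasible_directions v -> feasible_directions (u + v).
Proof.
move=> [k [y [k0 Dy ->]]] [l [y' [l0 Dy' ->]]].
have [y'' Dy'' e] := convex_setD cD Dy Dy' k0 l0.
exists (k + l), y''; split=> //; first exact: addr_ge0.
by rewrite !scalerBr -e scalerDl opprD addrACA.
Qed.

Lemma feasible_directionsZ s u : 0 <= s -> feasible_directions u ->
  feasible_directions (s *: u).
Proof.
move=> s0 [k [y [k0 Dy ->]]].
by exists (s * k), y; rewrite scalerA mulr_ge0.
Qed.

End feasible_directions.

Section coord_proj_theory.
Context {R : realType} (X : tvsType R).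
Context n (e : 'I_n -> X) (phi : 'I_n -> topdual X).
Local Notation P := (coord_proj e phi).

Lemma coord_projD u v : P (u + v) = P u + P v.
Proof.
by rewrite -big_split/=; apply: eq_bigr => i _; rewrite linearD scalerDl.
Qed.

Lemma coord_projZ s u : P (s *: u) = s *: P u.
Proof.
by rewrite scaler_sumr; apply: eq_bigr => i _; rewrite linearZ scalerA.
Qed.

Lemma coord_proj0 : P 0 = 0.
Proof. by rewrite -(scale0r (0 : X)) coord_projZ !scale0r. Qed.

Lemma coord_projN u : P (- u) = - P u.
Proof. by rewrite -scaleN1r coord_projZ scaleN1r. Qed.

(** Composing with the continuous projection turns any linear functional into a
    continuous one. *)
Lemma topdual_coord_proj (xi : {linear X -> R^o}) :
  exists k : topdual X, forall v, k v = xi (P v).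
Proof.
exists (\sum_i (xi (e i) : R) *: phi i) => v; rewrite topdual_sumE linear_sum.
by apply: eq_bigr => i _; rewrite linearZ mulrC.
Qed.

End coord_proj_theory.

Section relative_interior.
Context {R : realType} (X : tvsType R) (hX : hausdorff_space X).
Variables (D : set X) (x : X).
Hypotheses (cD : @convex_set R X D) (Dx : D x).
Variables (n : nat) (e : 'I_n -> X) (phi : 'I_n -> topdual X).
Hypotheses (bio : biorthogonal e phi) (De : forall i, D (x + e i)).
Hypothesis (DP : forall y, D y -> y - x = coord_proj e phi (y - x)).

Local Notation C := (feasible_directions D x).
Local Notation P := (coord_proj e phi).

Lemma feasible_directions_coord_proj u : C u -> P u = u.
Proof. by move=> [k [y [_ Dy ->]]]; rewrite coord_projZ -DP. Qed.

Lemma feasible_directions_comb (c : 'I_n -> R) : (forall i, 0 <= c i) ->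
  C (\sum_i c i *: e i).
Proof.
move=> c0; elim/big_ind : _ => [|u v|i _]; first exact: feasible_directions0.
  exact: feasible_directionsD.
by exists (c i), (x + e i); split=> //; rewrite addrC addKr.
Qed.

Let w := \sum_i e i.

Lemma feasible_directions_sum : C w.
Proof.
have -> : w = \sum_i (1 : R) *: e i by apply: eq_bigr => i _; rewrite scale1r.
exact: feasible_directions_comb.
Qed.

(** Relative to the span of [C], adding a large multiple of the sum of the
    coordinate vectors makes all the coordinates nonnegative. *)
Lemma core_sum v : exists2 s, 0 <= s & C (P v + s *: w).
Proof.
exists (\sum_i `|phi i v|); first by apply: sumr_ge0.
rewrite /w scaler_sumr -big_split/=.
under eq_bigr do rewrite -scalerDl.
apply: feasible_directions_comb => i.
rewrite (bigD1 i)//= addrA addr_ge0//; last by apply: sumr_ge0.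
by have := ler_norm (- phi i v); rewrite normrN -subr_ge0 opprK addrC.
Qed.

(** If [z] is outside the span of [D - x], a functional vanishing on that span is
    nonzero at [z]. Otherwise, if [z + s0 *: w] is not feasible, the constraints
    [xi <= 0] on [C], [xi (- w) <= 1] and [xi (- z) <= - s0] are compatible: a
    conflict would make some [z + s *: w] feasible with [s < s0]. *)
Lemma core_or_normal z : (forall s, 0 < s -> C (z + s *: w)) \/
  exists2 k : topdual X, forall u, C u -> k u <= 0 & 0 < k z.
Proof.
have [zP|zP] := pselect (z = P z); last first.
  have [psi [psie psiz]] := biorthogonal_annihilator hX bio zP.
  right; exists psi => [u /feasible_directions_coord_proj <-|].
    by rewrite linear_sum big1// => i _; rewrite linearZ/= psie scaler0.
  by rewrite psiz ltr01.
have [all|] := pselect (forall s, 0 < s -> C (z + s *: w)); first by left.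
move=> /existsNP[s0 /not_implyP[s0_gt0 zs0]]; right.
pose E := [set p : X * R | exists r k,
  [/\ 0 <= r, 0 <= k, C (P p.1 + r *: w + k *: z) & p.2 = r - k * s0]].
have [|||xi xiE] := @cone_hahn_banach R X E.
- split.
  + exists 0, 0; split=> //=; last by rewrite mul0r subr0.
    by rewrite coord_proj0 !scale0r !addr0; exact: feasible_directions0.
  + move=> u v a b [r [k [/= r0 k0 Cu ->]]] [r' [k' [/= r0' k0' Cv ->]]].
    exists (r + r'), (k + k'); split=> /=; [exact: addr_ge0|exact: addr_ge0| |].
      have := feasible_directionsD cD Cu Cv.
      by rewrite coord_projD !scalerDl addrACA (addrACA (P u)).
    by rewrite mulrDl opprD addrACA.
  + move=> s u a sgt0 [r [k [/= r0 k0 Cu ->]]].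
    exists (s * r), (s * k); split=> /=; [by rewrite mulr_ge0// ltW..| |].
      have := feasible_directionsZ (ltW sgt0) Cu.
      by rewrite coord_projZ !scalerDr !scalerA.
    by rewrite mulrBr mulrA.
- move=> a [r [k [/= r0 k0]]]; rewrite coord_proj0 add0r => Cz ->.
  rewrite subr_ge0; move: k0; rewrite le_eqVlt => /predU1P[<-|k0].
    by rewrite mul0r.
  rewrite leNgt; apply/negP => rks; apply: zs0.
  have kV : 0 <= k^-1 by rewrite invr_ge0 ltW.
  have s0r : 0 <= s0 - k^-1 * r.
    by rewrite subr_ge0 ler_pdivrMl// ltW.
  have := feasible_directionsD cD (feasible_directionsZ kV Cz)
    (feasible_directionsZ s0r feasible_directions_sum).
  rewrite scalerDr !scalerA mulVf ?gt_eqF// scale1r addrAC -scalerDl.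
  by rewrite addrC addrCA subrr addr0.
- move=> u; have [r r0 Cr] := core_sum u.
  by exists r, r, 0; split=> //=; rewrite ?scale0r ?addr0// mul0r subr0.
have [k kE] := topdual_coord_proj e phi xi.
exists k => [u Cu|]; rewrite kE.
  rewrite feasible_directions_coord_proj//; apply: xiE.
  exists 0, 0; split=> //=; last by rewrite mul0r subr0.
  by rewrite feasible_directions_coord_proj// !scale0r !addr0.
rewrite -zP; apply: lt_le_trans s0_gt0 _; rewrite -lerN2 -linearN; apply: xiE.
exists 0, 1; split=> //=; last by rewrite mul1r sub0r.
rewrite coord_projN -zP scale0r addr0 scale1r addNr.
exact: feasible_directions0.
Qed.

End relative_interior.

(** * Subgradients at core directions *)

Section subgradient_at_core.
Context {R : realType} (X : tvsType R).
Variables (D : set X) (x : X) (n : nat) (e : 'I_n -> X) (phi : 'I_n -> topdual X).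
Hypotheses (cD : @convex_set R X D) (Dx : D x).
Hypothesis (DP : forall y, D y -> y - x = coord_proj e phi (y - x)).
Local Notation C := (feasible_directions D x).
Local Notation P := (coord_proj e phi).

(** The constraints are the subgradient inequalities [k (y - x) <= r], for [r]
    above [g y - a], and [k (- u) <= - c]. Since [u] is in the core, they bound
    [k] in every direction; the assumption on slopes is the compatibility of the
    last one with the others. *)
Lemma core_subgradient (g : X -> \bar R) (a c : R) u :
  epi_convex g -> (forall y, D y -> (g y < +oo)%E) ->
  C u -> (forall v, exists2 s, 0 <= s & C (P v + s *: u)) ->
  (forall s k y r, 0 <= s -> 0 <= k -> D y -> s *: u = k *: (y - x) ->
     (g y <= (a + r)%:E)%E -> s * c <= k * r) ->
  exists k : topdual X, c <= k u /\
    forall y r, D y -> (g y <= (a + r)%:E)%E -> k (y - x) <= r.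
Proof.
move=> cg gD Cu coreu slope.
pose G : set (X * R^o)%type := [set p | D p.1 /\ (g p.1 <= (a + p.2)%:E)%E].
have cG : @convex_set R (X * R^o)%type G.
  apply/convex_setP => -[y r] [y' r'] l l01 [/= Dy gy] [/= Dy' gy']; split => /=.
    by move/convex_setP : cD; exact.
  have := cg _ _ _ _ _ l01 gy gy'.
  have -> // : l * (a + r) + (1 - l) * (a + r') = a + (l * r + (1 - l) * r') by ring.
pose E := [set p : X * R | exists s k y r, [/\ 0 <= s, 0 <= k, G (y, r),
  P p.1 + s *: u = k *: (y - x) & p.2 + s * c = k * r]].
have Gex y : D y -> exists r, G (y, r).
  move=> Dy; have [r gr] := lt_pinfty_le_EFin (gD _ Dy).
  by exists (r - a); split=> //=; rewrite addrC subrK.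
have [|||xi xiE] := @cone_hahn_banach R X E.
- split.
  + have [r Gr] := Gex x Dx.
    exists 0, 0, x, r; split=> //=; last by rewrite !mul0r addr0.
    by rewrite coord_proj0 !scale0r addr0.
  + move=> v v' b b' [s [k [y [r [s0 k0 Gy /= vE bE]]]]].
    move=> [s' [k' [y' [r' [s0' k0' Gy' /= vE' bE']]]]].
    have [[y'' r''] Gy'' []] := convex_setD cG Gy Gy' k0 k0'.
    move=> yE rE; exists (s + s'), (k + k'), y'', r''.
    split=> //=; [exact: addr_ge0|exact: addr_ge0| |].
      rewrite coord_projD scalerDl addrACA vE vE' !scalerBr -yE.
      by rewrite scalerDl opprD addrACA.
    by rewrite mulrDl addrACA bE bE' rE.
  + move=> t v b t0 [s [k [y [r [s0 k0 Gy /= vE bE]]]]].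
    exists (t * s), (t * k), y, r; split=> //=; [by rewrite mulr_ge0// ltW..| |].
      by rewrite coord_projZ -!scalerA -scalerDr vE.
    by rewrite -!mulrA -mulrDr bE.
- move=> b [s [k [y [r [/= s0 k0 [/= Dy gy] vE bE]]]]].
  rewrite coord_proj0 add0r in vE.
  by have := slope _ _ _ _ s0 k0 Dy vE gy; rewrite -bE lerDr.
- move=> v; have [s s0 [k [y [k0 Dy vE]]]] := coreu v.
  have [r Gr] := Gex y Dy.
  by exists (k * r - s * c), s, k, y, r; split=> //=; rewrite subrK.
have [k kE] := topdual_coord_proj e phi xi.
exists k; split=> [|y r Dy gy]; rewrite kE.
  rewrite -lerN2 -linearN; apply: xiE; have [r Gr] := Gex x Dx.
  exists 1, 0, x, r; split=> //=; last by rewrite mul1r mul0r addNr.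
  rewrite coord_projN !(feasible_directions_coord_proj DP Cu).
  by rewrite scale1r scale0r addNr.
rewrite -DP//; apply: xiE; exists 0, 1, y, r; split=> //=.
  by rewrite -DP// scale0r addr0 scale1r.
by rewrite mul0r addr0 mul1r.
Qed.

End subgradient_at_core.

(** * Steep subgradients at active indices *)

Section affine_minorant.
Context {R : realType} (X : tvsType R).

Lemma affine_lsc (xs : topdual X) (a : R) x :
  lower_semicontinuous (fun y => (a + xs (y - x))%:E).
Proof.
move=> y b; rewrite lte_fin => ab.
have := topdual_funP xs; rewrite inE => -[_ /(_ y) cxs].
have ab' : b - a + xs x < xs y.
  by move: ab; rewrite linearB -ltrBlDl ltrBrDr.
exists [set z | b - a + xs x < xs z].
  exact: (cvgr_gt _ cxs).
move=> z /= bz; rewrite lte_fin linearB.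
by rewrite -ltrBlDl ltrBrDr.
Qed.

End affine_minorant.

Section active_subgradients.
Context {R : realType} (X : tvsType R) (hX : hausdorff_space X).
Context (T : topologicalType) (f_ : T -> X -> \bar R).
Local Notation f := (esup_fun f_).
Hypotheses (f_convex : forall t, convex_efun (f_ t))
  (cl_sup : lsc_envelope f = esup_fun (fun t => lsc_envelope (f_ t))).
Variables (x : X) (eps0 : R).
Hypotheses (eps0_gt0 : 0 < eps0) (compact_active : compact (eps_active f_ eps0 x))
  (usc_active : forall z, edom (lsc_envelope f) z ->
      upper_semicontinuous_on (eps_active f_ eps0 x)
        (fun t => lsc_envelope (f_ t) z)).
Variables (a : R) (xs : topdual X).
Hypothesis (fx : f x = a%:E).
Hypothesis (xs_sub : forall y, ((a + xs (y - x))%:E <= f y)%E).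

Let h t := lsc_envelope (f_ t).

Let f_epi t : epi_convex (f_ t). Proof. exact: convex_efun_epi. Qed.

Let f_le t y : (f_ t y <= f y)%E.
Proof. by apply: ereal_sup_ubound; exists t. Qed.

Lemma convex_edom_sup : @convex_set R X (edom f).
Proof.
apply/convex_setP => y z l l01 /lt_pinfty_le_EFin[b yb] /lt_pinfty_le_EFin[c zc].
by apply: le_lt_trans (epi_convex_esup f_epi l01 yb zc) _; rewrite ltry.
Qed.

Lemma active_along y : edom f y -> exists t,
  f_ t x = a%:E /\
    forall mu, 0 < mu <= 1 ->
      ((a + mu * xs (y - x))%:E <= h t (mu *: y + (1 - mu) *: x)%R)%E.
Proof.
move=> fy; have [b yb] := lt_pinfty_le_EFin fy.
have hf t z : (h t z <= f z)%E by exact: le_trans (lsc_envelope_le _ _) _.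
have [||||||||t [htx ht]] := @active_index R T X h (eps_active f_ eps0 x) x y a b
    (xs (y - x)) eps0.
- by move=> t; exact: epi_convex_lsc_envelope.
- by move=> t; rewrite -fx.
- by move=> t; exact: le_trans yb.
- exact: compact_active.
- exact: eps0_gt0.
- move=> t htx; rewrite /eps_active /= fx -EFinB.
  exact: le_trans htx (lsc_envelope_le _ _).
- move=> mu /andP[mu0 mu1]; apply: usc_active.
  apply: le_lt_trans (lsc_envelope_le _ _) _.
  move: mu1; rewrite le_eqVlt => /predU1P[->|mu1].
    by rewrite scale1r subrr scale0r addr0.
  have fxD : edom f x by rewrite /edom /= fx ltry.
  by move/convex_setP : convex_edom_sup; apply => //; rewrite mu0.
- move=> mu _; rewrite -cl_sup.
  have -> : mu * xs (y - x) = xs (mu *: y + (1 - mu) *: x - x).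
    rewrite -topdualZ; congr (xs _).
    by rewrite scalerBr scalerBl scale1r addrA addrAC addrK.
  apply: (@lsc_envelope_max R X f (fun y => (a + xs (y - x))%:E)) => //.
  exact: affine_lsc.
exists t; split=> //; apply/eqP; rewrite eq_le -{1}fx f_le/=.
exact: le_trans htx (lsc_envelope_le _ _).
Qed.

Section subspace.
Variables (L : set X) (s : seq X).
Hypotheses (Ls : L = lin_span s) (Lx : L x).

Let D := L `&` edom f.

Let Lcomb u v (b c : R) : L u -> L v -> L (b *: u + c *: v).
Proof.
rewrite Ls => -[p _ <-] [q _ <-]; exists (fun i => b * p i + c * q i) => //.
rewrite !scaler_sumr -big_split/=; apply: eq_bigr => i _.
by rewrite scalerDl !scalerA.
Qed.

Let cD : @convex_set R X D.
Proof.
apply/convex_setP => y z l l01 [Ly fy] [Lz fz]; split; first exact: Lcomb.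
by move/convex_setP : convex_edom_sup; apply.
Qed.

Let Dx : D x. Proof. by split=> //; rewrite /edom /= fx ltry. Qed.

(** The subgradient inequality without infinite values: [r] stands for any real
    upper bound of [f_ t y - a]. *)
Let local_subgradient t (k : topdual X) :=
  forall y r, D y -> (f_ t y <= (a + r)%:E)%E -> k (y - x) <= r.

Lemma local_subgradientP t k : f_ t x = a%:E -> local_subgradient t k ->
  subdifferential (fun y => (f_ t y + eindicator D y)%dE) x k.
Proof.
move=> ftx kt; have Ex : (f_ t x + eindicator D x)%dE = a%:E.
  by rewrite ftx /eindicator mem_set// dadde0.
split=> [|y]; rewrite Ex// /eindicator; case: ifPn => [/set_mem Dy|_]; last first.
  by case: (f_ t y) => [r| |]; rewrite /= leey.
rewrite dadde0; case E : (f_ t y) => [r| |].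
- rewrite -EFinB lee_fin; apply: kt => //.
  by rewrite E addrC subrK.
- by rewrite leey.
- have := kt y (k (y - x) - 1) Dy; rewrite E leNye => /(_ isT).
  by rewrite lerBrDr gerDl ler10.
Qed.

(** When [z] is a limit of core directions [z + s1 *: w], the subgradient steep
    along [z + s1 *: w] loses at most [s1 * (beta - xs w)] at [z], where [beta]
    bounds every active subgradient at [w]. Otherwise a multiple of a normal
    functional that is positive at [z] is added to the subgradient for [w]. *)
Lemma active_subgradient_ge z d : 0 < d -> exists t (k : topdual X),
  [/\ active f_ x t,
      subdifferential (fun y => (f_ t y + eindicator D y)%dE) x k &
      xs z - d <= k z].
Proof.
move=> d0.
have DLs : [set u | D (x + u)] `<=` lin_span s.
  move=> u [Lxu _]; rewrite -Ls.
  have := Lcomb 1 (-1) Lxu Lx.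
  by rewrite scale1r scaleN1r addrC addKr.
have [n [e [phi [bio De DPu]]]] := maximal_biorthogonal hX DLs.
have DP y : D y -> y - x = coord_proj e phi (y - x).
  by move=> Dy; apply: DPu => /=; rewrite addrC subrK.
set w := \sum_i e i.
have sub u : feasible_directions D x u ->
    (forall v, exists2 s, 0 <= s &
       feasible_directions D x (coord_proj e phi v + s *: u)) ->
  exists t (k : topdual X),
    [/\ f_ t x = a%:E, local_subgradient t k & xs u <= k u].
  move=> /[dup] Cu [k0 [y [k00 Dy uE]]] coreu.
  have [t [ftx ht]] := active_along Dy.2.
  have hf z' : (h t z' <= f_ t z')%E by exact: lsc_envelope_le.
  have [||k l y' r k1 l0 Dy' kl fr|k [ku kt]] :=
      @core_subgradient R X D x n e phi cD Dx DP (f_ t) a (xs u) u _ _ Cu coreu.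
  - exact: f_epi.
  - by move=> y' [_]; exact: le_lt_trans.
  - have kxs : k * xs u = l * xs (y' - x).
      by rewrite -!topdualZ kl.
    move: l0; rewrite le_eqVlt => /predU1P[l0|l0].
      by rewrite kxs -l0 !mul0r.
    rewrite kxs ler_pM2l//.
    pose mu := l^-1 * (k * k0).
    have y'x : y' - x = mu *: (y - x).
      by rewrite -!scalerA -uE kl scalerA mulVf ?gt_eqF// scale1r.
    have y'E : mu *: y + (1 - mu) *: x = y'.
      by rewrite -[y'](subrK x) y'x scalerBr scalerBl scale1r addrA addrAC.
    rewrite y'x topdualZ.
    have [mu0|mu0] := leP mu 0.
      have {}mu0 : mu = 0.
        by apply/eqP; rewrite eq_le mu0 mulr_ge0 ?mulr_ge0// invr_ge0 ltW.
      rewrite mu0 mul0r -(lerD2l a) addr0 -lee_fin -ftx.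
      by rewrite -[x](_ : y' = x)// -y'E mu0 scale0r add0r subr0 scale1r.
    (* within the segment the active index was chosen for this; beyond [y],
       convexity between [x] and [y'] brings the inequality at [y] to [y'] *)
    have [mu1|mu1] := leP mu 1.
      rewrite -(lerD2l a) -lee_fin; apply: le_trans fr; apply: le_trans (hf _).
      by rewrite -y'E; apply: ht; rewrite mu0.
    have muV : 0 < mu^-1 < 1 by rewrite invr_gt0 mu0 invf_lt1.
    rewrite -ler_pdivlMl// -(lerD2l a) -lee_fin.
    have := ht 1; rewrite scale1r subrr scale0r addr0 mul1r ltr01 lexx => /(_ isT).
    move=> /le_trans; apply; apply: le_trans (hf _) _.
    have fxa : (f_ t x <= a%:E)%E by rewrite ftx.
    have := f_epi muV fr fxa; rewrite -y'E scalerDr !scalerA mulVf ?gt_eqF//.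
    rewrite scale1r -addrA -scalerDl.
    have -> : mu^-1 * (1 - mu) + (1 - mu^-1) = 0 by field; rewrite gt_eqF.
    rewrite scale0r addr0; have -> // : mu^-1 * (a + r) + (1 - mu^-1) * a =
      a + mu^-1 * r by ring.
  by exists t, k.
have /choice[b bE] : forall i, exists b : R, (f (x + e i)%R <= b%:E)%E.
  by move=> i; apply: lt_pinfty_le_EFin; case: (De i).
pose beta := \sum_i (b i - a).
have kw t k : local_subgradient t k -> k w <= beta.
  move=> kt; rewrite linear_sum; apply: ler_sum => i _.
  have := kt (x + e i) (b i - a) (De i).
  rewrite (addrAC x) subrr add0r (addrC a) subrK; apply.
  exact: le_trans (bE i).
have Cw : feasible_directions D x w by exact: feasible_directions_sum.
have [all|[m mC mz]] := core_or_normal hX cD Dx bio De DP z.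
  pose s1 := d / (`|beta - xs w| + 1).
  have K0 : 0 < `|beta - xs w| + 1 by rewrite ltr_wpDl.
  have s10 : 0 < s1 by rewrite divr_gt0.
  have [||t [k [ftx kt ku]]] := sub (z + s1 *: w).
  - exact: all.
  - move=> v; have [r r0 Cr] := core_sum cD Dx phi De v.
    have r'0 : 0 <= r / (s1 / 2) by rewrite divr_ge0// divr_ge0// ltW.
    exists (r / (s1 / 2)) => //.
    have -> : coord_proj e phi v + (r / (s1 / 2)) *: (z + s1 *: w) =
        (coord_proj e phi v + r *: w) + (r / (s1 / 2)) *: (z + (s1 / 2) *: w).
      rewrite !scalerDr !scalerA [RHS]addrACA [LHS]addrA; congr (_ + _).
      by rewrite -scalerDl; congr (_ *: _); field; rewrite gt_eqF.
    apply: feasible_directionsD => //; apply: feasible_directionsZ => //.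
    by apply: all; rewrite divr_gt0.
  exists t, k; split.
  - by rewrite /active /= fx.
  - exact: local_subgradientP.
  have ku' : xs z + s1 * xs w <= k z + s1 * k w.
    by move: ku; rewrite !linearD /= !topdualZ.
  have h1 : s1 * k w <= s1 * beta by rewrite ler_pM2l//; exact: kw kt.
  have h2 : s1 * (beta - xs w) <= d.
    rewrite /s1 mulrAC ler_pdivrMr// ler_pM2l//.
    by apply: le_trans (ler_norm _) _; rewrite lerDl.
  rewrite lerBlDr -(lerD2r (s1 * xs w)); apply: le_trans ku' _.
  rewrite -addrA lerD2l; apply: le_trans h1 _.
  by rewrite -lerBlDr -mulrBr.
have [|t [k [ftx kt ku]]] := sub w Cw.
  by move=> v; have [r r0 Cr] := core_sum cD Dx phi De v; exists r.
pose M := `|xs z - k z| / m z.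
have M0 : 0 <= M by rewrite divr_ge0// ltW.
have kt' : local_subgradient t (k + M *: m).
  move=> y r Dy fr; rewrite -[_ (y - x)]/(k (y - x) + M * m (y - x) : R).
  rewrite -[r]addr0 lerD//; first exact: kt.
  rewrite mulr_ge0_le0//; apply: mC; exists 1, y; rewrite scale1r.
  by split.
exists t, (k + M *: m); split.
- by rewrite /active /= fx.
- exact: local_subgradientP.
rewrite -[leRHS]/(k z + M * m z : R) divfK ?gt_eqF// -lerBlDl.
apply: le_trans (ler_norm _).
by rewrite addrAC gerDl lerNl oppr0 ltW.
Qed.

End subspace.
End active_subgradients.

(** * Weak-star closed convex hulls *)

Section weak_star.
Context {R : realType} (X : tvsType R).

Lemma topdual_eval_continuous z : continuous (fun k : topdual X => (k z : R^o)).
Proof.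
move=> k; pose ev := fun k : topdual X => (k : {ptws X -> R^o}).
have ev_cont : {for k, continuous ev} by exact: initial_continuous.
exact: (continuous_comp ev_cont (@proj_continuous X (fun=> R^o) z (ev k))).
Qed.

Lemma topdual_cvg (F : set_system (topdual X)) (k : topdual X) : Filter F ->
  (forall z, (fun phi : topdual X => (phi z : R^o)) @ F --> (k z : R^o)) ->
  F --> k.
Proof.
move=> FF Fk.
have Fev : {ptws, (fun phi : topdual X => (phi : X -> R^o)) @ F --> (k : X -> R^o)}.
  by apply/pointwise_cvgP => z; exact: Fk.
move=> A [_ [[W oW <-] Wk WA]].
apply: filterS WA _; apply: Fev.
exact: open_nbhs_nbhs.
Qed.

Lemma convex_convex_hull (A : set (topdual X)) : @convex_set R _ (convex_hull A).
Proof.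
apply/convex_setP => k k' l l01 Ak Ak' B [/= cB AB].
by have /convex_setP := cB; apply => //; [apply: Ak|apply: Ak'].
Qed.

Lemma sub_convex_hull (A : set (topdual X)) : A `<=` convex_hull A.
Proof. by move=> k Ak B [_]; exact. Qed.

Lemma closed_convex_hull_min (A : set (topdual X)) z c :
  (forall k, A k -> k z <= c) -> forall k, closed_convex_hull A k -> k z <= c.
Proof.
move=> Ac k; have Sclosed : closed [set k : topdual X | k z <= c].
  apply: (@closed_comp _ _ (fun k : topdual X => (k z : R^o)) [set r | r <= c]).
    by move=> ? _; exact: topdual_eval_continuous.
  exact: closed_le.
move=> /(closureS _) kA; apply: Sclosed; apply: kA => phi; apply; split => //.
apply/convex_setP => phi1 phi2 l /andP[l0 l1] /= h1 h2.
rewrite -[leLHS]/(l * phi1 z + (1 - l) * phi2 z : R).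
have -> : c = l * c + (1 - l) * c by ring.
by apply: lerD; apply: ler_wpM2l => //; rewrite ?subr_ge0 ltW.
Qed.

Lemma closed_convex_hull_neq0 (A : set (topdual X)) :
  closed_convex_hull A !=set0 -> A !=set0.
Proof.
move=> [k kA]; apply: contrapT => /nonemptyPn A0.
have [|phi [hphi _]] := kA setT; first exact: filterT.
suff : set0 phi by [].
apply: hphi; split; last by rewrite A0.
by apply/convex_setP.
Qed.

(** In the coordinates given by evaluation at the points of [s], the image of
    [K] stays at norm at least [eps] from that of [k]. The constraints are
    [xi <= N] for the norm [N], and [xi <= - eps] on the differences. A functional
    on row vectors is evaluation at a combination of the points of [s]. *)
Lemma weak_star_separation (K : set (topdual X)) (k : topdual X) (s : seq X) eps :
  @convex_set R _ K -> K !=set0 -> 0 < eps ->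
  (forall phi, K phi -> exists2 z, z \in s & eps < `|phi z - k z|) ->
  exists z, forall phi, K phi -> phi z <= k z - eps.
Proof.
move=> cK [phi0 Kphi0] eps0 far.
pose v (phi : topdual X) : 'rV[R]_(size s) :=
  \row_i ((phi s`_i : R) - (k s`_i : R)).
pose N (u : 'rV[R]_(size s)) := \sum_i `|u 0 i|.
have ND u u' : N (u + u') <= N u + N u'.
  by rewrite -big_split/=; apply: ler_sum => i _; rewrite mxE ler_normD.
have NZ c u : 0 <= c -> N (c *: u) = c * N u.
  move=> c0; rewrite mulr_sumr; apply: eq_bigr => i _.
  by rewrite mxE normrM ger0_norm.
have Nv phi : K phi -> eps <= N (v phi).
  move=> /far[z zs /ltW ez]; apply: le_trans ez _.
  have zi : (index z s < size s)%N by rewrite index_mem.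
  rewrite /N (bigD1 (Ordinal zi))//= mxE/= nth_index// lerDl.
  exact: sumr_ge0.
pose E := [set p : 'rV[R]_(size s) * R | exists r phi,
  [/\ 0 <= r, K phi & N (p.1 - r *: v phi) - r * eps <= p.2]].
have [|||xi xiE] := @cone_hahn_banach R _ E.
- split.
  + exists 0, phi0; split=> //=; rewrite scale0r mul0r !subr0.
    by rewrite /N big1// => i _; rewrite mxE normr0.
  + move=> u u' a a' [r [phi [r0 Kphi /= ua]]] [r' [phi' [r0' Kphi' /= ua']]].
    have [psi Kpsi psiE] := convex_setD cK Kphi Kphi' r0 r0'.
    exists (r + r'), psi; split=> //=; first exact: addr_ge0.
    have vE : (r + r') *: v psi = r *: v phi + r' *: v phi'.
      apply/rowP => i; rewrite !mxE.
      have := congr1 (fun f : topdual X => f s`_i) psiE.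
      rewrite -[LHS]/(r * phi s`_i + r' * phi' s`_i : R).
      rewrite -[RHS]/((r + r') * psi s`_i : R) => e.
      by rewrite mulrBr -e; ring.
    rewrite vE opprD addrACA mulrDl opprD.
    apply: le_trans (lerD ua ua'); rewrite [leRHS]addrACA.
    by apply: lerD => //; exact: ND.
  + move=> t u a t0 [r [phi [r0 Kphi /= ua]]].
    exists (t * r), phi; split=> //=; first by rewrite mulr_ge0// ltW.
    rewrite -scalerA -scalerBr (NZ _ _ (ltW t0)) -mulrA -mulrBr.
    by apply: ler_wpM2l => //; exact: ltW.
- move=> a [r [phi [r0 Kphi /=]]]; apply: le_trans.
  rewrite sub0r (_ : N _ = r * N (v phi)).
    by rewrite -mulrBr mulr_ge0// subr_ge0 Nv.
  by rewrite -NZ//; apply: eq_bigr => i _; rewrite mxE normrN.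
- move=> u; exists (N u), 0, phi0; split=> //=.
  by rewrite scale0r mul0r !subr0.
exists (\sum_i (xi (delta_mx 0 i) : R) *: s`_i) => phi Kphi.
rewrite lerBrDr -lerBrDl.
have : xi (v phi) <= - eps.
  apply: xiE; exists 1, phi; split=> //=; rewrite scale1r subrr mul1r.
  by rewrite /N big1 ?sub0r// => i _; rewrite mxE normr0.
have -> : xi (v phi) = phi (\sum_i (xi (delta_mx 0 i) : R) *: s`_i) -
    k (\sum_i (xi (delta_mx 0 i) : R) *: s`_i) :> R.
  have evalE (f : topdual X) : f (\sum_i (xi (delta_mx 0 i) : R) *: s`_i) =
      \sum_i (xi (delta_mx 0 i) : R) * f s`_i :> R.
    by rewrite linear_sum; apply: eq_bigr => i _; rewrite linearZ.
  rewrite !evalE -sumrB {1}(row_sum_delta (v phi)) linear_sum.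
  by apply: eq_bigr => i _; rewrite linearZ mxE -mulrBr mulrC.
by rewrite -[in X in _ -> X]lerN2 opprB.
Qed.

(** If no element of the hull were close to [k] at finitely many points, a vector
    would separate the hull from [k], against the assumption. The hull elements
    that are close to [k] at more and more points then form a filter base
    converging pointwise to [k]. *)
Lemma closed_convex_hull_support (A : set (topdual X)) (k : topdual X) :
  (forall z d, 0 < d -> exists2 phi, A phi & k z - d <= phi z) ->
  closed_convex_hull A k.
Proof.
move=> supp.
pose K := convex_hull A.
pose V (p : seq X * R) := [set phi | K phi /\
  forall z, z \in p.1 -> `|phi z - k z| <= p.2].
have V0 p : 0 < p.2 -> V p !=set0.
  move=> p0; apply: contrapT => noV.
  have K0 : K !=set0.
    have [phi Aphi _] := supp 0 1 ltr01.
    by exists phi; exact: sub_convex_hull.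
  have [|z zK] := weak_star_separation (@convex_convex_hull A) K0 p0 (k := k) (s := p.1).
    move=> phi Kphi; apply: contrapT => near; apply: noV; exists phi; split=> // z zp.
    by rewrite leNgt; apply/negP => far; apply: near; exists z.
  have [phi Aphi] := supp z (p.2 / 2) (divr_gt0 p0 (ltr0Sn _ 1)).
  apply/negP; rewrite -ltNge; apply: le_lt_trans (zK _ (sub_convex_hull Aphi)) _.
  by rewrite ltrD2l ltrN2 ltr_pdivrMr// ltr_pMr// ltr1n.
pose F := filter_from [set p : seq X * R | 0 < p.2] V.
have FF : Filter F.
  apply: filter_from_filter; first by exists ([::], 1) => /=.
  move=> p q /= p0 q0; exists (p.1 ++ q.1, Num.min p.2 q.2); rewrite /= ?lt_min ?p0//.
  move=> phi [Kphi near]; split; split=> // z zp;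
    have := near z; rewrite /= mem_cat zp ?orbT => /(_ isT);
    by rewrite le_min => /andP[].
have Fk : F --> k.
  apply: topdual_cvg => z; apply/cvgrPdist_le => e e0.
  exists ([:: z], e) => //= phi [_ near].
  by rewrite distrC; apply: near; rewrite mem_head.
move=> B /Fk[p p0 VB]; have [phi Vphi] := V0 p p0.
by exists phi; split; [exact: Vphi.1|exact: VB].
Qed.

End weak_star.

(** * Subdifferential of the supremum *)

Theorem theorem4 (R : realType) (X : tvsType R) (hX : hausdorff_space X)
    (T : topologicalType) (f_ : T -> X -> \bar R)
    (f_convex : forall t, convex_efun (f_ t))
    (cl_sup : lsc_envelope (esup_fun f_) =
              esup_fun (fun t => lsc_envelope (f_ t)))
    (x : X) (eps0 : R) (eps0_gt0 : 0 < eps0)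
    (compact_active : compact (eps_active f_ eps0 x))
    (usc_active : forall z, edom (lsc_envelope (esup_fun f_)) z ->
      upper_semicontinuous_on (eps_active f_ eps0 x)
        (fun t => lsc_envelope (f_ t) z)) :
  subdifferential (esup_fun f_) x =
  \bigcap_(L in fin_dim_subspaces_at x)
    closed_convex_hull
      (\bigcup_(t in active f_ x)
        subdifferential
          (fun y => (f_ t y + eindicator (L `&` edom (esup_fun f_)) y)%dE) x).
Proof.
apply/seteqP; split=> [xs [ffin xs_sub] L [[s Ls] Lx]|xs hxs].
  have fx : esup_fun f_ x = (fine (esup_fun f_ x))%:E by rewrite fineK.
  have xs_sub' y : ((fine (esup_fun f_ x) + xs (y - x))%:E <= esup_fun f_ y)%E.
    by rewrite EFinD -fx addeC -leeBrDr.
  apply: closed_convex_hull_support => z d d0.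
  have [t [k [ta kt kz]]] := active_subgradient_ge hX f_convex cl_sup eps0_gt0
    compact_active usc_active fx xs_sub' Ls Lx z d0.
  by exists k => //; exists t.
have span_mem s z : z \in s -> lin_span s z.
  move=> zs; have zi : (index z s < size s)%N by rewrite index_mem.
  exists (fun i => (i == Ordinal zi)%:R) => //.
  rewrite (bigD1 (Ordinal zi))//= eqxx scale1r nth_index// big1 ?addr0// => i.
  by move=> /negbTE ->; rewrite scale0r.
(* the subspace spanned by [x] and [y] is enough to test the inequality at [y] *)
pose L y := lin_span [:: x; y].
have Lfin y : fin_dim_subspaces_at x (L y).
  by split; [exists [:: x; y]|apply: span_mem; rewrite mem_head].
have Ly y : L y y by apply: span_mem; rewrite !inE eqxx orbT.
have Ind y z : L y z -> edom (esup_fun f_) z ->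
    eindicator (L y `&` edom (esup_fun f_)) z = 0%E.
  by move=> Lz fz; rewrite /eindicator mem_set.
have act y : exists t k, active f_ x t /\ subdifferential
    (fun z => (f_ t z + eindicator (L y `&` edom (esup_fun f_)) z)%dE) x k.
  have [k [t ta kt]] := closed_convex_hull_neq0 (ex_intro _ xs (hxs _ (Lfin y))).
  by exists t, k.
have ffin : esup_fun f_ x \is a fin_num.
  have [t [k [<- [+ _]]]] := act x.
  rewrite /eindicator; case: ifP => _; first by rewrite dadde0.
  by case: (f_ t x).
have fxD : edom (esup_fun f_) x by rewrite /edom /= ltey_eq ffin.
have key y t k : edom (esup_fun f_) y -> active f_ x t -> subdifferential
    (fun z => (f_ t z + eindicator (L y `&` edom (esup_fun f_)) z)%dE) x k ->
    ((k (y - x))%:E <= esup_fun f_ y - esup_fun f_ x)%E.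
  move=> fy tx [_ /(_ y)]; rewrite !Ind//; last exact: (Lfin y).2.
  rewrite !dadde0 tx => /le_trans; apply; apply: leeB => //.
  by apply: ereal_sup_ubound; exists t.
split=> // y; have [fy|] := pselect (edom (esup_fun f_) y); last first.
  move/negP; rewrite -leNgt leye_eq => /eqP ->.
  by rewrite -(fineK ffin) leey.
have [t [k [tx kt]]] := act y.
have := key _ _ _ fy tx kt; case E : (esup_fun f_ y) => [b| |].
- rewrite -(fineK ffin) -EFinB !lee_fin => _.
  apply: (closed_convex_hull_min _ (hxs _ (Lfin y))) => k' [t' tx' kt'].
  by have := key _ _ _ fy tx' kt'; rewrite E -(fineK ffin) -EFinB lee_fin.
- by move=> _; rewrite -(fineK ffin) leey.
- by rewrite addNye leeNy_eq.
Qed.
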